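(* Let $K\ge2$, $d\ge n\ge 1$, $\sigma^2>0$. Let $Z\sim\mathcal{N}(0,\sigma^2 I_d)$, and let $M=(M^1,\ldots,M^K)$ be an exchangeable family of random matrices in $\mathbb{R}^{n\times d}$, independent of $Z$, satisfying (i) (co-isometry) $M^k(M^k)^\top=I_n$ for every $k\in\{1,\ldots,K\}$; (ii) (sum-zero) $\sum_{k=1}^K M^k=0$. Define $\omega^k=M^kZ$ for $k\in\{1,\ldots,K\}$. Then the stacked vector $(\omega^1,\ldots,\omega^K)\in\mathbb{R}^{nK}$ is an exchangeable normal randomization with correlation $\rho=-1/(K-1)$ or, equivalently, with the zero-sum constraint $\sum_{k=1}^K\omega^k=0$.
   Context: Exchangeable family: $(M^{\pi(1)},\ldots,M^{\pi(K)})$ has the same distribution as $(M^1,\ldots,M^K)$ for every permutation $\pi$ of $\{1,\ldots,K\}$. Exchangeable normal randomization with correlation $\rho\in[-1/(K-1),1]$: (i) $(\omega^{\pi(1)},\ldots,\omega^{\pi(K)})$ has the same distribution as $(\omega^1,\ldots,\omega^K)$ for every permutation $\pi$ of $\{1,\ldots,K\}$; (ii) $\omega^k\sim\mathcal{N}(0,\sigma^2 I_n)$ for every $k$, and $\operatorname{Cov}(\omega^k,\omega^{k'})=\rho\sigma^2 I_n$ for every $k\ne k'$. For such a randomization, $\rho=-1/(K-1)$ and $\sum_{k=1}^K\omega^k=0$ almost surely are equivalent conditions (this is the meaning of ''equivalently''). Equalities between random quantities are understood almost surely. *)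

(* Defs.v *)
From HB Require Import structures.
From mathcomp Require Import all_boot all_order all_algebra all_fingroup.
From mathcomp Require Import all_classical all_reals all_analysis.

Set Implicit Arguments.
Unset Strict Implicit.
Unset Printing Implicit Defensive.

Import Order.TTheory GRing.Theory Num.Theory.
Import numFieldNormedType.Exports.

Local Open Scope classical_set_scope.
Local Open Scope ring_scope.

(* 'M[T]_(m, n) carries the sigma-algebra generated by the entry maps, i.e.
   the product sigma-algebra; for T = R this is the Borel sigma-algebra of
   R^(m x n). *)
Definition measure_matrix_display : measure_display -> measure_display.
Proof. exact. Qed.

Definition g_sigma_entries d (T : measurableType d) (m n : nat) :
    set (set 'M[T]_(m, n)) :=
  <<s \bigcup_(ij in [set: 'I_m * 'I_n])
        preimage_set_system setT (fun A : 'M[T]_(m, n) => A ij.1 ij.2)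
          measurable >>.

Section measurable_matrix.
Context d (T : measurableType d) (m n : nat).

Let matrix_set0 : @g_sigma_entries d T m n set0.
Proof. exact: sigma_algebra0. Qed.

Let matrix_setC (A : set 'M[T]_(m, n)) :
  g_sigma_entries A -> g_sigma_entries (~` A).
Proof. exact: sigma_algebraC. Qed.

Let matrix_bigcup (F : (set 'M[T]_(m, n))^nat) :
  (forall i, g_sigma_entries (F i)) -> g_sigma_entries (\bigcup_i (F i)).
Proof. exact: sigma_algebra_bigcup. Qed.

HB.instance Definition _ :=
  @isMeasurable.Build (measure_matrix_display d) 'M[T]_(m, n)
    (@g_sigma_entries d T m n) matrix_set0 matrix_setC matrix_bigcup.

End measurable_matrix.

(* The measures distribution P X are functions on all sets; laws are compared
   on measurable sets only. *)
Definition same_law d d' (T : measurableType d) (U : measurableType d')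
    (R : realType) (P : probability T R) (X Y : T -> U) : Prop :=
  forall A : set U, measurable A -> P (X @^-1` A) = P (Y @^-1` A).

Definition independent d d1 d2 (T : measurableType d) (U1 : measurableType d1)
    (U2 : measurableType d2) (R : realType) (P : probability T R)
    (X : T -> U1) (Y : T -> U2) : Prop :=
  forall (A : set U1) (B : set U2), measurable A -> measurable B ->
    P (X @^-1` A `&` Y @^-1` B) = (P (X @^-1` A) * P (Y @^-1` B))%E.

Definition joint (T U : Type) (K : nat) (X : 'I_K -> T -> U) (t : T) :
    K.-tuple U :=
  [tuple X k t | k < K].

Definition exchangeable d d' (T : measurableType d) (U : measurableType d')
    (R : realType) (P : probability T R) (K : nat) (X : 'I_K -> T -> U) : Prop :=
  forall s : 'S_K, same_law P (joint (fun k => X (s k))) (joint X).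

(* N(m, v) on the real line, parametrised by its variance. The degenerate law
   is written separately because normal_prob m 0 is not a Dirac mass. *)
Definition normal_law (R : realType) (m v : R) (A : set R) : \bar R :=
  if v == 0 then \d_m A else normal_prob m (Num.sqrt v) A.

(* X ~ N(mu, Sigma): every linear form a^T X is univariate normal, with mean
   a^T mu and variance a^T Sigma a. *)
Definition normal_vector d (T : measurableType d) (R : realType)
    (P : probability T R) (n : nat) (mu : 'cV[R]_n) (Sigma : 'M[R]_n)
    (X : T -> 'cV[R]_n) : Prop :=
  [/\ measurable_fun setT X,
      Sigma^T = Sigma,
      forall a : 'cV[R]_n, 0 <= (a^T *m Sigma *m a) 0 0 &
      forall (a : 'cV[R]_n) (A : set R), measurable A ->
        P ((fun t => (a^T *m X t) 0 0) @^-1` A) =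
        normal_law ((a^T *m mu) 0 0) ((a^T *m Sigma *m a) 0 0) A].

Definition cov_mx d (T : measurableType d) (R : realType)
    (P : probability T R) (m n : nat) (X : T -> 'cV[R]_m) (Y : T -> 'cV[R]_n) :
    'M[\bar R]_(m, n) :=
  \matrix_(i < m, j < n)
    covariance P (fun t => X t i 0) (fun t => Y t j 0).

(* The stacked vector (omega^1, ..., omega^K) of R^(nK) is represented by the
   family of its blocks. *)
Definition exchangeable_normal_randomization d (T : measurableType d)
    (R : realType) (P : probability T R) (K n : nat) (sigma2 rho : R)
    (omega : 'I_K -> T -> 'cV[R]_n) : Prop :=
  [/\ - 1 / (K%:R - 1) <= rho <= 1,
      exchangeable P omega,
      forall k, normal_vector P 0 sigma2%:M (omega k) &
      forall k k', k != k' ->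
        cov_mx P (omega k) (omega k') = map_mx EFin (rho * sigma2)%:M].

(* Main.v *)
Require Import Defs.
From HB Require Import structures.
From mathcomp Require Import all_boot all_order all_algebra all_fingroup.
From mathcomp Require Import all_classical all_reals all_analysis.
From mathcomp Require Import measurable_realfun ring lra.

Set Implicit Arguments.
Unset Strict Implicit.
Unset Printing Implicit Defensive.

Import Order.TTheory GRing.Theory Num.Theory.
Import numFieldNormedType.Exports.

Local Open Scope classical_set_scope.
Local Open Scope ring_scope.

(** Freeze the matrices M^k, which is possible because they are independent of
    Z: Fubini turns every probability about (M, Z) into an average over the law
    of M of probabilities about Z alone ([independent_preimage]).

    Three facts follow. Exchangeability passes from M to omega, since the law
    of (M, Z) is the product of the laws and so does not change when the M^k are
    permuted ([exchangeable_comp_independent]). Each omega^k is N(0, sigma2 I),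
    because a co-isometry m maps N(0, sigma2 I_d) to N(0, sigma2 m m^T)
    = N(0, sigma2 I_n) whatever m is ([normal_vector_coisometry]). And the
    omega^k sum to (sum_k M^k) Z = 0.

    The correlation is then forced: by exchangeability all cross covariances
    are equal, and they must compensate the variance in the covariance of
    omega^k with the zero sum ([covariance_of_sum0]).

    For the equivalence, a randomization with correlation rho has a sum whose
    coordinates are centred with variance K sigma2 (1 + (K - 1) rho)
    ([variance_sum_randomization]); this is 0 exactly for rho = - 1 / (K - 1),
    and a centred variable is almost surely 0 exactly when its variance is.

    Normality being stated through the laws of linear forms, all moments come
    from one analytic computation, the second moment of a normal law
    ([integral_sqr_normal_prob]). *)

(** * The second moment of a centred normal law *)

(** The probability normal_prob m s is defined by its density, so integrals
    against it should be Lebesgue integrals; the Radon-Nikodym derivative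
    supplies the change of variables and is almost everywhere the density. *)
Lemma integral_normal_prob (R : realType) (m s : R) (f : measurableTypeR R -> \bar R) :
    measurable_fun setT f -> (forall x, 0 <= f x)%E ->
  (\int[normal_prob m s]_x f x =
   \int[lebesgue_measure]_x (f x * (normal_pdf m s x)%:E))%E.
Proof.
move=> mf f0.
have numu := @normal_prob_dominates R m s.
rewrite -(Radon_Nikodym_SigmaFinite.change_of_variables numu f0 measurableT mf).
apply: ae_eq_integral => //.
- apply: emeasurable_funM => //.
  exact: measurable_int (Radon_Nikodym_SigmaFinite.f_integrable numu).
- apply: emeasurable_funM => //; apply/measurable_EFinP.
  exact: measurable_normal_pdf.
- apply: ae_eqe_mul2l; apply: integral_ae_eq => //.
  + exact: Radon_Nikodym_SigmaFinite.f_integrable.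
  + by apply/measurable_EFinP; exact: measurable_normal_pdf.
  + move=> A _ mA.
    by rewrite -(Radon_Nikodym_SigmaFinite.f_integral numu mA).
Qed.

(** This makes - s^2 * pdf an antiderivative of x * pdf, which is what the
    integration by parts below needs. *)
Lemma is_derive_normal_pdf (R : realType) (s x : R) : s != 0 ->
  is_derive x 1 (normal_pdf 0 s) (- (x * normal_pdf 0 s x) / s ^+ 2).
Proof.
move=> s0; rewrite (normal_pdfE _ s0) /normal_fun.
under eq_fun do rewrite subr0.
have s20 : s ^+ 2 *+ 2 != 0 by rewrite mulrn_eq0 expf_eq0 /= (negbTE s0).
apply: is_derive_eq; rewrite /GRing.scale/= subr0.
by field.
Qed.

(** The boundary term of the integration by parts vanishes: the bound
    exp (- y) <= 1 / y makes x * exp (- x^2 / (2 s^2)) at most 2 s^2 / x. *)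
Lemma cvg_mulr_normal_pdf (R : realType) (s : R) : s != 0 ->
  n%:R * normal_pdf 0 s n%:R @[n --> \oo] --> (0 : R).
Proof.
move=> s0; rewrite (normal_pdfE _ s0) /normal_fun.
have s2gt0 : 0 < s ^+ 2 by rewrite exprn_even_gt0.
have c0 : 0 <= normal_peak s by exact: normal_peak_ge0.
have := @cvgr_idn R; rewrite -gtr0_cvgV0; last first.
  by near=> n; rewrite ltr0n; near: n; exact: nbhs_infty_gt.
move=> /(cvgM (cvg_cst (normal_peak s * (s ^+ 2 *+ 2)))); rewrite mulr0.
apply: squeeze_cvgr; last exact: cvg_cst.
near=> n.
have n0 : 0 < n%:R :> R by rewrite ltr0n; near: n; exact: nbhs_infty_gt.
apply/andP; split.
  by rewrite mulr_ge0// ?mulr_ge0// expR_ge0.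
rewrite subr0 mulrCA /= -mulrA ler_wpM2l// mulNr expRN.
have y0 : 0 < n%:R ^+ 2 / (s ^+ 2 *+ 2) :> R.
  by rewrite divr_gt0 ?exprn_gt0// mulrn_wgt0.
have -> : (s ^+ 2 *+ 2) / n%:R = n%:R * (n%:R ^+ 2 / (s ^+ 2 *+ 2))^-1.
  by field; rewrite s0 gt_eqF.
rewrite ler_wpM2l ?(ltW n0)// lef_pV2 ?posrE ?expR_gt0//.
by apply: le_trans (expR_ge1Dx _); rewrite lerDr.
Unshelve. all: by end_near. Qed.

(** Integration by parts of x * (x * pdf), with - s^2 * pdf as antiderivative
    of the second factor. *)
Lemma integral_sqr_normal_pdf_itv (R : realType) (s : R) (n : nat) : s != 0 ->
  (0 < n)%N ->
  (\int[lebesgue_measure]_(x in `[0%R, n%:R]) (x ^+ 2 * normal_pdf 0 s x)%:E =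
   (- s ^+ 2 * (n%:R * normal_pdf 0 s n%:R))%:E +
   (s ^+ 2)%:E *
   \int[lebesgue_measure]_(x in `[0%R, n%:R]) (normal_pdf 0 s x)%:E)%E.
Proof.
move=> s0 n0.
have n0R : 0 < n%:R :> R by rewrite ltr0n.
have cpdf : continuous (@normal_pdf R 0 s) by exact: continuous_normal_pdf.
have dpdf x := @is_derive_normal_pdf R s x s0.
transitivity (\int[lebesgue_measure]_(x in `[0%R, n%:R])
    (x * (x * normal_pdf 0 s x))%:E)%E.
  by apply: eq_integral => x _; rewrite expr2 mulrA.
pose G : R -> R := fun x => - s ^+ 2 * normal_pdf 0 s x.
have cG : continuous G.
  by move=> x; apply: cvgM; [exact: cvg_cst | exact: cpdf].
have dG (x : R) : is_derive x 1 G (x * normal_pdf 0 s x).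
  by apply: is_derive_eq; rewrite /GRing.scale/=; field.
have cg : continuous (fun x : R => x * normal_pdf 0 s x).
  by move=> x; apply: cvgM; [exact: cvg_id | exact: cpdf].
rewrite (@integration_by_parts R id G (cst 1) (fun x => x * normal_pdf 0 s x)
  0 n%:R)//.
- rewrite /= mul0r subr0 /G mulrCA; congr (_ + _)%E.
  under eq_integral do rewrite mul1r EFinM.
  rewrite integralZl//=; last first.
    by apply: (integrableS measurableT) => //; exact: integrable_normal_pdf.
  by rewrite EFinN mulNe oppeK.
- by apply: continuous_subspaceT => x; exact: cvg_cst.
- by split => [x _| |]; [exact: derivable_id|exact: cvg_at_right_filter|
    exact: cvg_at_left_filter].
- by move=> x _; rewrite derive1E derive_id.
- exact: continuous_subspaceT.
- by split => [x _| |]; [by have [] := dG x|apply: cvg_at_right_filter; exact: cG|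
    apply: cvg_at_left_filter; exact: cG].
- by move=> x _; rewrite derive1E; have [] := dG x.
Qed.

(** By evenness the claim is about the half-line, where the previous identity
    passes to the limit: the boundary term tends to 0, and both integrals
    converge by monotonicity since their integrands are nonnegative. What is
    left is s^2 times the total mass. *)
Lemma integral_sqr_normal_prob (R : realType) (s : R) : s != 0 ->
  (\int[normal_prob 0 s]_x (x ^+ 2)%:E = (s ^+ 2)%:E)%E.
Proof.
move=> s0.
rewrite (@integral_normal_prob R 0 s (fun x : measurableTypeR R => (x ^+ 2)%:E)).
pose f2 (x : R) := x ^+ 2 * normal_pdf 0 s x.
have cpdf : continuous (@normal_pdf R 0 s) by exact: continuous_normal_pdf.
have pdf0 x : 0 <= normal_pdf 0 s x by exact: normal_pdf_ge0.
have cf2 : continuous f2.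
  by move=> x; apply: cvgM; [exact: exprn_continuous | exact: cpdf].
have f20 x : 0 <= f2 x by rewrite mulr_ge0 ?sqr_ge0.
have even_pdf : normal_pdf 0 s =1 normal_pdf 0 s \o -%R.
  by move=> x /=; rewrite normal_pdfE// /normal_fun !subr0 sqrrN.
have even_f2 : f2 =1 f2 \o -%R.
  by move=> x; rewrite /f2/= sqrrN even_pdf.
have half : (\int[lebesgue_measure]_(x in `[0%R, +oo[) (f2 x)%:E = (s ^+ 2)%:E *
    \int[lebesgue_measure]_(x in `[0%R, +oo[) (normal_pdf 0 s x)%:E)%E.
  have L := @ge0_cvgn_integral R lebesgue_measure f2 f20
    (continuous_measurable_fun cf2).
  have L1 := @ge0_cvgn_integral R lebesgue_measure _ pdf0
    (measurable_normal_pdf 0 s).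
  apply: (cvg_unique _ L) => //; rewrite -[((s ^+ 2)%:E * _)%E]add0e.
  have a0 : (- s ^+ 2 * (n%:R * normal_pdf 0 s n%:R))%:E @[n --> \oo] -->
      (0%:E : \bar R).
    apply: cvg_EFin; first exact: nearW.
    have := cvgM (cvg_cst (- s ^+ 2)) (cvg_mulr_normal_pdf s0).
    by rewrite mulr0 => h; exact: h.
  have /(cvgeD _ a0) : ((s ^+ 2)%:E * \int[lebesgue_measure]_(x in `[0%R, n%:R])
      (normal_pdf 0 s x)%:E @[n --> \oo] --> (s ^+ 2)%:E *
      \int[lebesgue_measure]_(x in `[0%R, +oo[) (normal_pdf 0 s x)%:E)%E.
    exact: cvgeZl.
  rewrite fin_num_adde_defr// => /(_ isT) h; move: h; apply: cvg_trans.
  apply: near_eq_cvg; near=> n.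
  apply/esym/integral_sqr_normal_pdf_itv => //.
  by near: n; exact: nbhs_infty_gt.
transitivity (\int[lebesgue_measure]_x (f2 x)%:E)%E.
  by apply: eq_integral => x _; rewrite -EFinM.
rewrite (ge0_symfun_integralT f20 cf2 even_f2) -set_itvcy half muleCA.
rewrite set_itvcy -(ge0_symfun_integralT pdf0 cpdf even_pdf).
by rewrite integral_normal_pdf mule1.
- by apply/measurable_EFinP; exact: measurable_funX.
- by move=> x; rewrite lee_fin sqr_ge0.
Unshelve. all: by end_near. Qed.

(** * Measurability of matrices and tuples *)

(** The sigma-algebra on matrices is the coarsest one making the entries
    measurable, whence this criterion. *)
Lemma measurable_fun_mxP d d' (S : measurableType d) (T : measurableType d')
    (m n : nat) (f : S -> 'M[T]_(m, n)) :
  measurable_fun setT f <->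
  forall i j, measurable_fun setT (fun s => f s i j).
Proof.
split=> [mf i j _ A mA|mf].
  rewrite setTI -[X in measurable X]setTI.
  apply: (mf measurableT ((fun B : 'M[T]_(m, n) => B i j) @^-1` A)).
  apply: sub_sigma_algebra; exists (i, j) => //.
  by exists A => //; rewrite setTI.
apply: (@measurability _ _ _ _ _ _
  (\bigcup_(ij in [set: 'I_m * 'I_n])
     preimage_set_system setT (fun A : 'M[T]_(m, n) => A ij.1 ij.2)
       measurable)) => //.
move=> _ [_ [[i j] _ [A mA <-]] <-]; rewrite !setTI.
by rewrite -[X in measurable X]setTI; exact: mf.
Qed.

Lemma measurable_mulmx d (S : measurableType d) (R : realType) (m n p : nat)
    (f : S -> 'M[R]_(m, n)) (g : S -> 'M[R]_(n, p)) :
  measurable_fun setT f -> measurable_fun setT g ->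
  measurable_fun setT (fun s => f s *m g s).
Proof.
move=> /measurable_fun_mxP mf /measurable_fun_mxP mg.
apply/measurable_fun_mxP => i j.
under eq_fun do rewrite mxE.
by apply: measurable_sum => k; exact: measurable_funM.
Qed.

Lemma measurable_linear_form d (T : measurableType d) (R : realType) (n : nat)
    (X : T -> 'cV[R]_n) (a : 'cV[R]_n) :
  measurable_fun setT X -> measurable_fun setT (fun t => (a^T *m X t) 0 0).
Proof.
move=> mX; have := @measurable_mulmx _ T R _ _ _ (cst a^T) X.
by move=> /(_ (measurable_cst _) mX)/measurable_fun_mxP; exact.
Qed.

Lemma measurable_joint d d' (S : measurableType d) (U : measurableType d')
    (K : nat) (X : 'I_K -> S -> U) :
  (forall k, measurable_fun setT (X k)) -> measurable_fun setT (joint X).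
Proof.
move=> mX; apply/measurable_fun_tnthP => k.
rewrite (_ : _ \o _ = X k)//; apply/funext => t /=.
by rewrite /joint tnth_mktuple.
Qed.

(** * Laws and expectations *)

(** Stated for any nu that agrees with the law of X on measurable sets, so as to
    apply both to explicit laws (a Dirac mass, a normal probability) and to the
    law of another variable. *)
Lemma ge0_integral_law d d' (T : measurableType d) (U : measurableType d')
    (R : realType) (P : probability T R) (X : T -> U)
    (nu : {measure set U -> \bar R}) (f : U -> \bar R) :
  measurable_fun setT X ->
  (forall A, measurable A -> P (X @^-1` A) = nu A) ->
  measurable_fun setT f -> (forall u, 0 <= f u)%E ->
  (\int[P]_t f (X t) = \int[nu]_u f u)%E.
Proof.
move=> mX PX mf f0.
pose Xm : {mfun T >-> U} := mfun_Sub (mem_set mX).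
transitivity (\int[distribution P Xm]_u f u)%E.
  by rewrite ge0_integral_distribution.
by apply: eq_measure_integral => A mA _; exact: PX.
Qed.

Lemma same_law_ge0_integral d d' (T : measurableType d) (U : measurableType d')
    (R : realType) (P : probability T R) (X Y : T -> U) (f : U -> \bar R) :
  measurable_fun setT X -> measurable_fun setT Y -> same_law P X Y ->
  measurable_fun setT f -> (forall u, 0 <= f u)%E ->
  (\int[P]_t f (X t) = \int[P]_t f (Y t))%E.
Proof.
move=> mX mY XY mf f0.
pose Ym : {mfun T >-> U} := mfun_Sub (mem_set mY).
rewrite (@ge0_integral_law _ _ _ _ _ _ X (distribution P Ym))//.
by rewrite ge0_integral_distribution.
Qed.

Lemma same_law_expectation d d' (T : measurableType d) (U : measurableType d')
    (R : realType) (P : probability T R) (X Y : T -> U) (h : U -> R) :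
  measurable_fun setT X -> measurable_fun setT Y -> same_law P X Y ->
  measurable_fun setT h ->
  ('E_P[fun t => h (X t)] = 'E_P[fun t => h (Y t)])%E.
Proof.
move=> mX mY XY mh; rewrite unlock.
have mEh : measurable_fun setT (EFin \o h) by apply/measurable_EFinP.
rewrite integralE [RHS]integralE.
rewrite (funepos_comp (EFin \o h) X) (funepos_comp (EFin \o h) Y).
rewrite (funeneg_comp (EFin \o h) X) (funeneg_comp (EFin \o h) Y).
congr (_ - _)%E.
  apply: (same_law_ge0_integral (f := (EFin \o h)^\+%E)) => //.
  exact: measurable_funepos.
apply: (same_law_ge0_integral (f := (EFin \o h)^\-%E)) => //.
exact: measurable_funeneg.
Qed.

Lemma same_law_covariance d d' (T : measurableType d) (U : measurableType d')
    (R : realType) (P : probability T R) (X Y : T -> U) (f g : U -> R) :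
  measurable_fun setT X -> measurable_fun setT Y -> same_law P X Y ->
  measurable_fun setT f -> measurable_fun setT g ->
  covariance P (fun t => f (X t)) (fun t => g (X t)) =
  covariance P (fun t => f (Y t)) (fun t => g (Y t)).
Proof.
move=> mX mY XY mf mg; rewrite unlock.
rewrite (same_law_expectation mX mY XY mf) (same_law_expectation mX mY XY mg).
set a := fine 'E_P[_]; set b := fine 'E_P[_].
apply: (same_law_expectation (h := fun u => (f u - a) * (g u - b)) mX mY XY).
by apply: measurable_funM; apply: measurable_funB.
Qed.

(** * Independence *)

Lemma independent_compl d d1 d2 d3 (T : measurableType d)
    (U1 : measurableType d1) (U2 : measurableType d2) (V : measurableType d3)
    (R : realType) (P : probability T R) (X : T -> U1) (Y : T -> U2)
    (g : U1 -> V) :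
  measurable_fun setT g -> independent P X Y ->
  independent P (fun t => g (X t)) Y.
Proof.
move=> mg XY A B mA mB; apply: (XY (g @^-1` A)) => //.
by rewrite -[X in measurable X]setTI; exact: mg.
Qed.

(** Independence says that the law of (X, Y) and the product of the two laws
    agree on rectangles, hence everywhere; Fubini then computes probabilities
    by freezing the value of X. The measurability of g comes along because it
    is needed each time this integral is used. *)
Lemma independent_preimage d d1 d2 d3 (T : measurableType d)
    (U1 : measurableType d1) (U2 : measurableType d2) (V : measurableType d3)
    (R : realType) (P : probability T R) (X : T -> U1) (Y : T -> U2)
    (F : U1 * U2 -> V) (A : set V) :
  measurable_fun setT X -> measurable_fun setT Y -> independent P X Y ->
  measurable_fun setT F -> measurable A ->
  let g x := P ((fun t => F (x, Y t)) @^-1` A) in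
  measurable_fun setT g /\
  P ((fun t => F (X t, Y t)) @^-1` A) = (\int[P]_w g (X w))%E.
Proof.
move=> mX mY XY mF mA g.
pose Xm : {mfun T >-> U1} := mfun_Sub (mem_set mX).
pose Ym : {mfun T >-> U2} := mfun_Sub (mem_set mY).
have mXY : measurable_fun setT (fun t => (X t, Y t)).
  exact: measurable_fun_pair.
pose XYm : {mfun T >-> (U1 * U2)%type} := mfun_Sub (mem_set mXY).
have mFA : measurable (F @^-1` A) by rewrite -[X in measurable X]setTI; exact: mF.
have gE : g = distribution P Ym \o xsection (F @^-1` A).
  apply/funext => x /=; rewrite /distribution/= /pushforward/=; congr (P _).
  by apply/seteqP; split=> t /=; rewrite /xsection/= inE.
have mg : measurable_fun setT g by rewrite gE; exact: measurable_fun_xsection.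
split=> //.
transitivity (distribution P XYm (F @^-1` A)) => //.
rewrite -(@product_measure_unique _ _ _ _ R (distribution P Xm)
  (distribution P Ym) (distribution P XYm) XY _ mFA).
by rewrite /product_measure1 -gE ge0_integral_distribution.
Qed.

(** After freezing the first variable, only its law matters. *)
Lemma independent_same_law d d1 d2 d3 (T : measurableType d)
    (U1 : measurableType d1) (U2 : measurableType d2) (V : measurableType d3)
    (R : realType) (P : probability T R) (X X' : T -> U1) (Y : T -> U2)
    (F : U1 * U2 -> V) :
  measurable_fun setT X -> measurable_fun setT X' -> measurable_fun setT Y ->
  independent P X Y -> independent P X' Y -> same_law P X X' ->
  measurable_fun setT F ->
  same_law P (fun t => F (X t, Y t)) (fun t => F (X' t, Y t)).
Proof.
move=> mX mX' mY XY X'Y XX' mF A mA.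
have [mg ->] := independent_preimage mX mY XY mF mA.
have [_ ->] := independent_preimage mX' mY X'Y mF mA.
by apply: (same_law_ge0_integral
  (f := fun x => P ((fun t => F (x, Y t)) @^-1` A))).
Qed.

(** * Expectation and covariance of square-integrable variables *)

Lemma Lfun2_sqr_integral d (T : measurableType d) (R : realType)
    (P : probability T R) (f : T -> R) :
  measurable_fun setT f -> (\int[P]_t (f t ^+ 2)%:E < +oo)%E ->
  f \in Lfun P 2%:E.
Proof.
move=> mf f2; rewrite inE; apply/andP; split; rewrite inE//=.
rewrite /finite_norm unlock poweR_lty//.
apply: le_lt_trans f2; rewrite le_eqVlt; apply/orP; left; apply/eqP.
apply: eq_integral => t _ /=.
by rewrite powR_mulrn ?normr_ge0// -normrX ger0_norm// sqr_ge0.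
Qed.

Lemma ae_eq_expectation d (T : measurableType d) (R : realType)
    (P : probability T R) (X Y : T -> R) :
  measurable_fun setT X -> measurable_fun setT Y ->
  (\forall t \ae P, X t = Y t) -> ('E_P[X] = 'E_P[Y])%E.
Proof.
move=> mX mY XY; rewrite unlock; apply: ae_eq_integral => //.
- exact/measurable_EFinP.
- exact/measurable_EFinP.
- by apply: filterS XY => t /= -> _.
Qed.

Lemma covariance_ae0r d (T : measurableType d) (R : realType)
    (P : probability T R) (X Y : T -> R) :
  measurable_fun setT X -> measurable_fun setT Y ->
  (\forall t \ae P, Y t = 0) -> covariance P X Y = 0%E.
Proof.
move=> mX mY Y0; rewrite unlock.
rewrite (@ae_eq_expectation _ _ _ P Y (cst 0))// expectation_cst/=.
rewrite (@ae_eq_expectation _ _ _ P _ (cst 0)) ?expectation_cst//.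
- apply: measurable_funM; apply: measurable_funB => //.
- by apply: filterS Y0 => t /= Yt; rewrite !fctE/= Yt subr0 mulr0.
Qed.

Lemma expectation_sqr_eq0 d (T : measurableType d) (R : realType)
    (P : probability T R) (X : T -> R) :
  measurable_fun setT X -> ('E_P[X ^+ 2] = 0)%E -> \forall t \ae P, X t = 0.
Proof.
move=> mX; rewrite unlock => E0.
have : ae_eq P setT (fun t => (X t ^+ 2)%:E) (cst 0%E).
  apply/(ae_eq_integral_abs P measurableT).
    by apply/measurable_EFinP; exact: measurable_funX.
  rewrite -[RHS]E0; apply: eq_integral => t _.
  by rewrite gee0_abs ?lee_fin ?sqr_ge0.
apply: filterS => t /= /(_ I) [] /eqP.
by rewrite sqrf_eq0 => /eqP.
Qed.

Lemma expectation_finsum d (T : measurableType d) (R : realType)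
    (P : probability T R) (I : finType) (Y : I -> T -> R) :
  (forall i, Y i \in Lfun P 1) ->
  ('E_P[fun t => (\sum_i Y i t)%R] = \sum_i 'E_P[Y i])%E.
Proof.
move=> Y1; rewrite -fct_sumE.
suff [] : (\sum_i Y i)%R \in Lfun P 1 /\
  ('E_P[\sum_i Y i] = \sum_i 'E_P[Y i])%E by [].
elim/big_rec2: _ => [|i e S _ [S1 IH]].
  by split; [exact: Lfun_cst|rewrite expectation_cst].
by split; [rewrite rpredD|rewrite expectationD// IH].
Qed.

Lemma Lfun2_sum d (T : measurableType d) (R : realType)
    (P : probability T R) (I : finType) (Y : I -> T -> R) :
  (forall i, Y i \in Lfun P 2%:E) -> (fun t => \sum_i Y i t) \in Lfun P 2%:E.
Proof. by move=> Y2; rewrite -fct_sumE rpred_sum ?lee1n. Qed.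

Lemma covariance_sumr d (T : measurableType d) (R : realType)
    (P : probability T R) (I : finType) (X : T -> R) (Y : I -> T -> R) :
  X \in Lfun P 2%:E -> (forall i, Y i \in Lfun P 2%:E) ->
  covariance P X (fun t => \sum_i Y i t) = (\sum_i covariance P X (Y i))%E.
Proof.
move=> X2 Y2; rewrite -fct_sumE.
suff [] : \sum_i Y i \in Lfun P 2%:E /\
  covariance P X (\sum_i Y i) = (\sum_i covariance P X (Y i))%E by [].
elim/big_rec2: _ => [|i c S _ [S2 IH]].
  by split; [exact: Lfun_cst|rewrite covariance_cst_r].
by split; [rewrite rpredD ?lee1n|rewrite covarianceDr// IH].
Qed.

(** * Centred normal vectors *)

(** For v = 0 the law is a Dirac mass, which has no density and is not
    normal_prob 0 0, so this case does not follow from the density computation. *)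
Lemma normal_law_second_moment d (T : measurableType d) (R : realType)
    (P : probability T R) (X : T -> R) (v : R) :
  measurable_fun setT X -> 0 <= v ->
  (forall A, measurable A -> P (X @^-1` A) = normal_law 0 v A) ->
  (\int[P]_t (X t ^+ 2)%:E = v%:E)%E.
Proof.
move=> mX v0 PX.
have mf : measurable_fun setT (fun x : R => (x ^+ 2)%:E).
  by apply/measurable_EFinP; exact: measurable_funX.
have f0 (x : R) : (0 <= (x ^+ 2)%:E)%E by rewrite lee_fin sqr_ge0.
have [v_eq0|v_neq0] := eqVneq v 0.
  rewrite (@ge0_integral_law _ _ _ _ _ P X (\d_(0 : R)) (fun x => (x ^+ 2)%:E))//.
    by rewrite integral_dirac// diracT mul1e expr0n v_eq0.
  by move=> A mA; rewrite PX// /normal_law v_eq0 eqxx.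
rewrite (@ge0_integral_law _ _ _ (measurableTypeR R) _ P X (normal_prob 0 (Num.sqrt v))
  (fun x => (x ^+ 2)%:E))//.
  rewrite integral_sqr_normal_prob ?sqr_sqrtr//.
  by rewrite gt_eqF// sqrtr_gt0 lt_def v_neq0.
by move=> A mA; rewrite PX// /normal_law (negbTE v_neq0).
Qed.

(** The mean vanishes by symmetry: the forms attached to a and - a have the
    same normal law, so the expectation is its own opposite. *)
Lemma normal_vector_linear_form d (T : measurableType d) (R : realType)
    (P : probability T R) (n : nat) (Sigma : 'M[R]_n) (X : T -> 'cV[R]_n)
    (a : 'cV[R]_n) :
  normal_vector P 0 Sigma X ->
  let Y := fun t => (a^T *m X t) 0 0 in
  [/\ Y \in Lfun P 2%:E, ('E_P[Y] = 0)%E &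
      covariance P Y Y = ((a^T *m Sigma *m a) 0 0)%:E].
Proof.
move=> [mX _ psd law] Y.
have mY : measurable_fun setT Y by exact: measurable_linear_form.
have EY2 : (\int[P]_t (Y t ^+ 2)%:E = ((a^T *m Sigma *m a) 0 0)%:E)%E.
  apply: normal_law_second_moment => // A mA.
  by rewrite law// mulmx0 mxE.
have Y2 : Y \in Lfun P 2%:E by apply: Lfun2_sqr_integral; rewrite ?EY2 ?ltry.
have Y1 : Y \in Lfun P 1 by apply: Lfun_subset12 => //; exact: fin_num_measure.
have YN : same_law P Y (fun t => - Y t).
  move=> A mA; rewrite law//.
  have -> : (fun t => - Y t) = (fun t => ((- a)^T *m X t) 0 0).
    by apply/funext => t; rewrite linearN mulNmx [RHS]mxE.
  have trN : (- a)^T = - a^T by rewrite linearN.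
  by rewrite (law (- a) A mA) trN !mulmx0 !mulNmx mulmxN opprK.
have EY : ('E_P[Y] = 0)%E.
  have := same_law_expectation (h := idfun) mY (measurableT_comp _ mY) YN.
  move=> /(_ _ (@measurable_id _ _ _))/=.
  have -> : ('E_P[fun t => (- Y t)%R] = - 'E_P[Y])%E.
    rewrite (_ : (fun t => - Y t) = -1 \o* Y); last first.
      by apply/funext => t /=; rewrite mulrN1.
    by rewrite expectationZl// EFinN mulNe mul1e.
  have := expectation_fin_num Y1.
  case: ('E_P[Y])%E => // r _ rN; congr EFin.
  have : r = - r by apply: EFin_inj; exact: (rN _).
  lra.
split => //.
rewrite -[LHS]/(variance P Y) varianceE// EY expe2 mule0 sube0 -EY2.
by rewrite unlock.
Qed.

Lemma normal_vector_coord d (T : measurableType d) (R : realType)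
    (P : probability T R) (n : nat) (Sigma : 'M[R]_n) (X : T -> 'cV[R]_n)
    (i : 'I_n) :
  normal_vector P 0 Sigma X ->
  (fun t => X t i 0) \in Lfun P 2%:E /\ ('E_P[fun t => (X t i 0)%R] = 0)%E.
Proof.
move=> /(@normal_vector_linear_form _ _ _ _ _ _ _ (delta_mx i 0))/= [].
rewrite (_ : (fun t => _) = fun t => X t i 0)//.
by apply/funext => t; rewrite trmx_delta -rowE mxE.
Qed.

(** Polarization: the variance of X_i + X_j is known both from the quadratic
    form of Sigma and from bilinearity of the covariance. *)
Lemma normal_vector_covariance d (T : measurableType d) (R : realType)
    (P : probability T R) (n : nat) (Sigma : 'M[R]_n) (X : T -> 'cV[R]_n)
    (i j : 'I_n) :
  normal_vector P 0 Sigma X ->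
  covariance P (fun t => X t i 0) (fun t => X t j 0) = (Sigma i j)%:E.
Proof.
move=> NX.
(* mxE would also expand the products inside A and B *)
have mxE_add (A B : 'M[R]_1) : (A + B) 0 0 = A 0 0 + B 0 0 by rewrite mxE.
have quad k l : ((delta_mx k 0)^T *m Sigma *m delta_mx l 0 : 'M[R]_1) 0 0 = Sigma k l.
  by rewrite trmx_delta -rowE -colE !mxE.
have coord k : (fun t => ((delta_mx k 0)^T *m X t : 'M[R]_1) 0 0) = fun t => X t k 0.
  by apply/funext => t; rewrite trmx_delta -rowE mxE.
have var k : covariance P (fun t => X t k 0) (fun t => X t k 0) = (Sigma k k)%:E.
  by have [_ _] := normal_vector_linear_form (delta_mx k 0) NX; rewrite coord quad.
have [Xi2 _] := normal_vector_coord i NX.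
have [Xj2 _] := normal_vector_coord j NX.
have trD : (delta_mx i 0 + delta_mx j 0 : 'cV[R]_n)^T =
    (delta_mx i 0)^T + (delta_mx j 0)^T by rewrite linearD.
have quadD : ((delta_mx i 0 + delta_mx j 0)^T *m Sigma *m
      (delta_mx i 0 + delta_mx j 0) : 'M[R]_1) 0 0 =
    Sigma i i + Sigma j i + (Sigma i j + Sigma j j).
  by rewrite trD !mulmxDr !mulmxDl !mxE_add !quad.
have [_ _] := normal_vector_linear_form (delta_mx i 0 + delta_mx j 0) NX.
rewrite (_ : (fun t => _) = (fun t => X t i 0) \+ (fun t => X t j 0)); last first.
  by apply/funext => t; rewrite trD mulmxDl mxE !trmx_delta -!rowE !mxE.
rewrite -[X in X = _]/(variance P _) varianceD//.
rewrite /variance !var quadD.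
have -> : Sigma j i = Sigma i j by case: NX => _ /matrixP/(_ i j); rewrite mxE.
have fin : covariance P (fun t => X t i 0) (fun t => X t j 0) \is a fin_num.
  apply: covariance_fin_num; last exact: Lfun2_mul_Lfun1.
    by apply: Lfun_subset12 => //; exact: fin_num_measure.
  by apply: Lfun_subset12 => //; exact: fin_num_measure.
case: (covariance _ _ _) fin => // r _ [h]; congr EFin.
lra.
Qed.

(** With the matrix frozen at x, the form a^T (x Z) is the form of Z attached
    to x^T a, whose variance s2 |x^T a|^2 = s2 |a|^2 does not depend on x as
    soon as x x^T = 1. Integrating over the law of X leaves this constant
    normal law. *)
Lemma normal_vector_coisometry d (T : measurableType d) (R : realType)
    (P : probability T R) (n m : nat) (s2 : R) (X : T -> 'M[R]_(n, m))
    (Z : T -> 'cV[R]_m) :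
  0 <= s2 -> measurable_fun setT X -> normal_vector P 0 s2%:M Z ->
  independent P X Z -> (\forall t \ae P, X t *m (X t)^T = 1%:M) ->
  normal_vector P 0 s2%:M (fun t => X t *m Z t).
Proof.
move=> s20 mX [mZ _ _ law] XZ iso; split.
- exact: measurable_mulmx.
- exact: tr_scalar_mx.
- move=> a; rewrite mul_mx_scalar -scalemxAl mxE mulr_ge0// mxE.
  by apply: sumr_ge0 => i _; rewrite mxE -expr2 sqr_ge0.
move=> a A mA.
pose F (p : 'M[R]_(n, m) * 'cV[R]_m) : R := (a^T *m (p.1 *m p.2)) 0 0.
have mF : measurable_fun setT F.
  by apply: measurable_linear_form; exact: measurable_mulmx.
have [mg ->] := independent_preimage mX mZ XZ mF mA.
pose v : R := (a^T *m s2%:M *m a) 0 0.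
have gE (x : 'M[R]_(n, m)) : x *m x^T = 1%:M ->
    P ((fun t => F (x, Z t)) @^-1` A) = normal_law 0 v A.
  move=> xx.
  have -> : (fun t => F (x, Z t)) = fun t => ((x^T *m a)^T *m Z t) 0 0.
    by apply/funext => t; rewrite /F/= trmx_mul trmxK mulmxA.
  have quad : (x^T *m a)^T *m s2%:M *m (x^T *m a) = a^T *m s2%:M *m a.
    rewrite trmx_mul trmxK !mul_mx_scalar -!scalemxAl.
    by rewrite -(mulmxA a^T x) (mulmxA x) xx mul1mx.
  by rewrite (law (x^T *m a) A mA) quad !mulmx0 mxE.
transitivity (\int[P]_w (cst (normal_law 0 v A) w))%E.
  apply: ae_eq_integral => //; first exact: (measurableT_comp mg mX).
  by apply: filterS iso => t tt _; rewrite gE.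
by rewrite integral_cst//= probability_setT mule1 mulmx0 mxE.
Qed.

(** * Exchangeable families *)

(** Permuting the family before or after applying f amounts to applying one
    fixed map F to (joint X, Y) with joint X permuted; the permuted family has
    the same law and is still independent of Y. *)
Lemma exchangeable_comp_independent d d1 d2 d3 (T : measurableType d)
    (U1 : measurableType d1) (U2 : measurableType d2) (V : measurableType d3)
    (R : realType) (P : probability T R) (K : nat) (X : 'I_K -> T -> U1)
    (Y : T -> U2) (f : U1 * U2 -> V) :
  (forall k, measurable_fun setT (X k)) -> measurable_fun setT Y ->
  measurable_fun setT f -> independent P (joint X) Y ->
  exchangeable P X -> exchangeable P (fun k t => f (X k t, Y t)).
Proof.
move=> mX mY mf XY exX s.
pose F (p : K.-tuple U1 * U2) : K.-tuple V := [tuple f (tnth p.1 k, p.2) | k < K].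
have mF : measurable_fun setT F.
  apply/measurable_fun_tnthP => k.
  rewrite (_ : _ \o _ = fun p : K.-tuple U1 * U2 => f (tnth p.1 k, p.2)).
    apply: measurableT_comp => //; apply: measurable_fun_pair => //.
    exact: (measurableT_comp (measurable_tnth k) measurable_fst).
  by apply/funext => p /=; rewrite tnth_mktuple.
pose perm (x : K.-tuple U1) : K.-tuple U1 := [tuple tnth x (s k) | k < K].
have mperm : measurable_fun setT perm.
  apply/measurable_fun_tnthP => k.
  rewrite (_ : _ \o _ = fun x : K.-tuple U1 => tnth x (s k)).
    exact: measurable_tnth.
  by apply/funext => x /=; rewrite tnth_mktuple.
have jointXs : joint (fun k => X (s k)) = fun t => perm (joint X t).
  by apply/funext => t; apply: eq_from_tnth => k; rewrite !tnth_mktuple.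
have -> : joint (fun k t => f (X (s k) t, Y t)) =
    fun t => F (joint (fun k => X (s k)) t, Y t).
  by apply/funext => t; apply: eq_from_tnth => k; rewrite !tnth_mktuple.
have -> : joint (fun k t => f (X k t, Y t)) = fun t => F (joint X t, Y t).
  by apply/funext => t; apply: eq_from_tnth => k; rewrite !tnth_mktuple.
apply: (@independent_same_law _ _ _ _ _ _ _ _ _ P
  (joint (fun k => X (s k))) (joint X) Y F) => //.
- exact: measurable_joint.
- exact: measurable_joint.
- by rewrite jointXs; exact: independent_compl.
Qed.

Lemma exchangeable_covariance d d' (T : measurableType d)
    (U : measurableType d') (R : realType) (P : probability T R) (K : nat)
    (X : 'I_K -> T -> U) (f g : U -> R) (s : 'S_K) (k k' : 'I_K) :
  (forall k, measurable_fun setT (X k)) ->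
  measurable_fun setT f -> measurable_fun setT g -> exchangeable P X ->
  covariance P (fun t => f (X (s k) t)) (fun t => g (X (s k') t)) =
  covariance P (fun t => f (X k t)) (fun t => g (X k' t)).
Proof.
move=> mX mf mg exX.
have mXs : measurable_fun setT (joint (fun k => X (s k))).
  exact: measurable_joint.
have mfk (h : U -> R) l : measurable_fun setT h ->
    measurable_fun setT (fun x : K.-tuple U => h (tnth x l)).
  by move=> mh; apply: measurableT_comp => //; exact: measurable_tnth.
have := same_law_covariance mXs (measurable_joint mX) (exX s)
  (mfk f k mf) (mfk g k' mg).
have tnthE (Y : 'I_K -> T -> U) (h : U -> R) l :
    (fun t => h (tnth (joint Y t) l)) = fun t => h (Y l t).
  by apply/funext => t; rewrite tnth_mktuple.
by rewrite !tnthE.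
Qed.

(** The covariances of X^k_i with the X^l_j sum to 0 over l. The term l = k is
    s2 if i = j and 0 otherwise, and by exchangeability the K - 1 other terms
    are equal, so each is - 1 / (K - 1) times the first. *)
Lemma covariance_of_sum0 d (T : measurableType d) (R : realType)
    (P : probability T R) (K n : nat) (s2 : R) (X : 'I_K -> T -> 'cV[R]_n)
    (k k' : 'I_K) (i j : 'I_n) :
  (forall k, normal_vector P 0 s2%:M (X k)) -> exchangeable P X ->
  (\forall t \ae P, \sum_(l < K) X l t = 0) -> k != k' ->
  covariance P (fun t => X k t i 0) (fun t => X k' t j 0) =
  ((- 1 / (K%:R - 1) * s2)%:M i j)%:E.
Proof.
move=> NX exX X0 kk'.
have mX l : measurable_fun setT (X l) by case: (NX l).
have mXc l i' : measurable_fun setT (fun t => X l t i' 0).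
  by move/measurable_fun_mxP : (mX l); exact.
pose c l := covariance P (fun t => X k t i 0) (fun t => X l t j 0).
have L2 l i' : (fun t => X l t i' 0) \in Lfun P 2%:E.
  by have [] := normal_vector_coord i' (NX l).
have csum := covariance_sumr (L2 k i) (fun l => L2 l j).
have sum0 : (\sum_(l < K) c l = 0)%E.
  rewrite -csum; apply: covariance_ae0r => //.
    by apply: measurable_sum => l.
  by apply: filterS X0 => t /matrixP/(_ j 0); rewrite summxE mxE.
have ck : c k = (s2%:M i j)%:E by exact: normal_vector_covariance.
have ck' l : l != k -> c l = c k'.
  move=> lk.
  have mcoord i' : measurable_fun setT (fun x : 'cV[R]_n => x i' 0).
    have /measurable_fun_mxP := @measurable_id _ 'cV[R]_n setT; exact.
  have := @exchangeable_covariance _ _ _ _ _ P K X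
    (fun x => x i 0) (fun x => x j 0) (tperm l k') k k' mX
    (mcoord i) (mcoord j) exX.
  by rewrite tpermR tpermD// eq_sym.
have fin : c k' \is a fin_num.
  apply: covariance_fin_num; last exact: Lfun2_mul_Lfun1.
    by apply: Lfun_subset12 => //; exact: fin_num_measure.
  by apply: Lfun_subset12 => //; exact: fin_num_measure.
rewrite -/(c k').
move: sum0; rewrite (bigD1 k)//= ck (eq_bigr (fun=> c k')) => [|l lk]; last first.
  exact: ck'.
have Kgt1 : (1 < K)%N.
  by rewrite -[K]card_ord; apply/card_gt1P; exists k, k'.
rewrite -(fineK fin) sumEFin sumr_const -EFinD => -[].
rewrite cardC1 card_ord -subn1 => h; congr EFin.
have K1 : K%:R - 1 != 0 :> R by rewrite subr_eq0 pnatr_eq1 gtn_eqF.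
apply: (mulIf K1); move: h.
rewrite !mxE -[_ *+ (K - 1)]mulr_natr natrB ?(ltnW Kgt1)// => h.
rewrite mulrnAl mulrAC divfK// mulN1r mulNrn.
by apply/eqP; rewrite -addr_eq0 addrC; apply/eqP.
Qed.

(** * Exchangeable normal randomizations *)

(** Expand the variance of the i-th coordinate of the sum: K terms s2 and
    K (K - 1) terms rho * s2. *)
Lemma variance_sum_randomization d (T : measurableType d) (R : realType)
    (P : probability T R) (K n : nat) (s2 rho : R) (X : 'I_K -> T -> 'cV[R]_n)
    (i : 'I_n) :
  exchangeable_normal_randomization P s2 rho X ->
  let S := fun t => \sum_(k < K) X k t i 0 in
  [/\ S \in Lfun P 2%:E, ('E_P[S] = 0)%E &
      covariance P S S = (K%:R * s2 * (1 + (K%:R - 1) * rho))%:E].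
Proof.
move=> [_ _ NX covX] S.
have L2 k : (fun t => X k t i 0) \in Lfun P 2%:E.
  by have [] := normal_vector_coord i (NX k).
have S2 : S \in Lfun P 2%:E by exact: Lfun2_sum.
have covS f : f \in Lfun P 2%:E ->
    covariance P f S = (\sum_k covariance P f (fun t => X k t i 0)%R)%E.
  by move=> f2; exact: covariance_sumr.
have covSX k : covariance P S (fun t => X k t i 0) =
    (s2 * (1 + (K%:R - 1) * rho))%:E.
  rewrite covarianceC covS//.
  rewrite (eq_bigr (fun l => (if l == k then s2 else rho * s2)%:E)); last first.
    move=> l _; have [->|lk] := eqVneq l k.
      by rewrite (normal_vector_covariance i i (NX k)) !mxE eqxx.
    have := covX k l; rewrite eq_sym lk => /(_ isT)/matrixP/(_ i i).
    by rewrite !mxE eqxx.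
  rewrite sumEFin (bigD1 k)//= eqxx (eq_bigr (fun=> rho * s2)); last first.
    by move=> l /negbTE ->.
  have K0 : (0 < K)%N by case: (K) k => // -[].
  rewrite sumr_const cardC1 card_ord -[rho * s2 *+ _]mulr_natr -subn1 natrB//.
  by congr EFin; ring.
split=> //.
- rewrite expectation_finsum => [|k].
    by rewrite big1// => k _; have [_] := normal_vector_coord i (NX k).
  by apply: Lfun_subset12 => //; exact: fin_num_measure.
- rewrite covS// (eq_bigr _ (fun k _ => covSX k)) sumEFin sumr_const card_ord.
  by congr EFin; rewrite -[LHS]mulr_natr; ring.
Qed.

(** A centred variable vanishes almost surely exactly when its variance does,
    and the variance of each coordinate of the sum is K s2 (1 + (K - 1) rho). *)
Lemma randomization_sum0P d (T : measurableType d) (R : realType)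
    (P : probability T R) (K n : nat) (s2 rho : R) (X : 'I_K -> T -> 'cV[R]_n) :
  (2 <= K)%N -> (1 <= n)%N -> 0 < s2 ->
  exchangeable_normal_randomization P s2 rho X ->
  rho = - 1 / (K%:R - 1) <-> \forall t \ae P, \sum_(k < K) X k t = 0.
Proof.
move=> K2 n1 s2gt0 RX.
have mS (i : 'I_n) : measurable_fun setT (fun t => \sum_(k < K) X k t i 0).
  apply: measurable_sum => k; case: RX => _ _ /(_ k)[mX _ _ _] _.
  by move/measurable_fun_mxP : mX; exact.
have K1 : K%:R - 1 != 0 :> R by rewrite subr_eq0 pnatr_eq1 gtn_eqF.
split=> [rhoE|X0].
  have S0 : \forall t \ae P, forall i : 'I_n, \sum_(k < K) X k t i 0 = 0.
    apply: filter_forall => i.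
    have [S2 ES VS] := variance_sum_randomization i RX.
    apply: expectation_sqr_eq0 => //.
    have := varianceE S2; rewrite ES expe2 mule0 sube0 => <-.
    rewrite /variance VS rhoE; congr EFin.
    by rewrite mulrCA divff// mulr1 subrr mulr0.
  apply: filterS S0 => t St; apply/matrixP => i j.
  by rewrite (ord1 j) summxE mxE.
have [S2 ES] := variance_sum_randomization (Ordinal n1) RX.
rewrite covariance_ae0r//; last first.
  by apply: filterS X0 => t /matrixP/(_ (Ordinal n1) 0); rewrite summxE mxE.
move=> [] /esym/eqP; rewrite !mulf_eq0 pnatr_eq0 (gt_eqF s2gt0) gtn_eqF ?(ltnW K2)//=.
rewrite addr_eq0 => /eqP rhoE; apply: (mulfI K1).
by rewrite mulrCA divff// mulr1 [in RHS]rhoE opprK.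
Qed.

(** * The randomization built from co-isometries *)

Theorem proposition4p1 (R : realType) (disp : measure_display)
    (T : measurableType disp) (P : probability T R) (K n d : nat) (sigma2 : R)
    (M : 'I_K -> {RV P >-> 'M[R]_(n, d)}) (Z : {RV P >-> 'cV[R]_d})
    (hK : (2 <= K)%N) (hn : (1 <= n)%N) (hd : (n <= d)%N) (hs : 0 < sigma2)
    (hZ : normal_vector P 0 sigma2%:M Z)
    (hM : exchangeable P (fun k => M k : T -> 'M[R]_(n, d)))
    (hMZ : independent P (joint (fun k => M k : T -> 'M[R]_(n, d))) Z)
    (hiso : forall k, \forall t \ae P, M k t *m (M k t)^T = 1%:M)
    (hsum : \forall t \ae P, \sum_(k < K) M k t = 0) :
  let omega := fun (k : 'I_K) (t : T) => M k t *m Z t in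
  [/\ exchangeable_normal_randomization P sigma2 (- 1 / (K%:R - 1)) omega,
      \forall t \ae P, \sum_(k < K) omega k t = 0 &
      forall (disp' : measure_display) (U : measurableType disp')
        (Q : probability U R) (rho : R) (xi : 'I_K -> U -> 'cV[R]_n),
        exchangeable_normal_randomization Q sigma2 rho xi ->
        rho = - 1 / (K%:R - 1) <->
        \forall u \ae Q, \sum_(k < K) xi k u = 0].
Proof.
move=> omega.
have mM k : measurable_fun setT (M k : T -> 'M[R]_(n, d)) by [].
have mZ : measurable_fun setT (Z : T -> 'cV[R]_d) by [].
have K1gt0 : 0 < K%:R - 1 :> R by rewrite subr_gt0 ltr1n.
have omega0 : \forall t \ae P, \sum_(k < K) omega k t = 0.
  by apply: filterS hsum => t Mt; rewrite -mulmx_suml Mt mul0mx.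
have exomega : exchangeable P omega.
  apply: (@exchangeable_comp_independent _ _ _ _ _ _ _ _ _ _ _ _ _
    (fun p : 'M[R]_(n, d) * 'cV[R]_d => p.1 *m p.2) mM mZ _ hMZ hM).
  exact: measurable_mulmx.
have normal_omega k : normal_vector P 0 sigma2%:M (omega k).
  apply: normal_vector_coisometry (hiso k) => //; first exact: ltW.
  have := independent_compl (measurable_tnth k) hMZ.
  rewrite (_ : (fun t => _) = M k)//.
  by apply/funext => t; rewrite tnth_mktuple.
split=> // [|disp' U Q rho xi]; last exact: randomization_sum0P.
split=> // [|k k' kk'].
  rewrite lexx /= (@le_trans _ _ 0)// mulN1r oppr_le0 invr_ge0.
  exact: ltW.
by apply/matrixP => i j; rewrite [LHS]mxE [RHS]mxE; exact: covariance_of_sum0.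
Qed.
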